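(* Let $p\ge 1$, $n=2p$, and let $A=[a_{ij}]=\begin{bmatrix}A_1&A_2\\ A_3&A_4\end{bmatrix}$ be an $n\times n$ $(0,1)$-matrix where each block $A_i$ is $p\times p$ and has exactly $k_i$ ones in every row and every column, with $k_i\le p$ ($i=1,2,3,4$) and $k_1+k_4=k_2+k_3$. Let $X'=[x'_{ij}]$ be the $n\times n$ matrix with $x'_{ij}=0$ when $a_{ij}=0$ and, when $a_{ij}=1$, \[ x'_{ij}=\begin{cases} k_4 & (i,j\le p),\\ k_3 & (i\le p,\ j>p),\\ k_2 & (i>p,\ j\le p),\\ k_1 & (i>p,\ j>p),\end{cases} \] and assume $x'_{ij}>0$ precisely when $a_{ij}=1$. Define $X=\frac{1}{k_1k_4+k_2k_3}X'$. Then $X$ is a doubly stochastic matrix whose zero entries are exactly the zero entries of $A$, and all diagonals of $X$ avoiding the zeros of $A$ have the same diagonal sum (that is, $X$ is an RCDS doubly stochastic matrix with pattern $A$).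
   Context: A square nonnegative matrix is doubly stochastic if all row and column sums equal $1$. For a permutation $\sigma$ of $\{1,\ldots,n\}$, the diagonal corresponding to $\sigma$ is the set of positions $(i,\sigma(i))$, with diagonal sum $\sum_i x_{i,\sigma(i)}$; it avoids the zeros of $A$ if $a_{i,\sigma(i)}=1$ for all $i$. *)

(* Defs.v *)
From HB Require Import structures.
From mathcomp Require Import all_boot all_order all_algebra all_fingroup.

Set Implicit Arguments.
Unset Strict Implicit.
Unset Printing Implicit Defensive.

Import Order.TTheory GRing.Theory Num.Theory.
Local Open Scope ring_scope.

Definition zero_one_mx (R : realFieldType) (m n : nat) (A : 'M[R]_(m, n)) : Prop :=
  forall i j, A i j = 0 \/ A i j = 1.

Definition ones_per_line (R : realFieldType) (p k : nat) (B : 'M[R]_p) : Prop :=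
  (forall i, #|[set j | B i j == 1]| = k) /\
  (forall j, #|[set i | B i j == 1]| = k).

Definition doubly_stochastic (R : realFieldType) (n : nat) (X : 'M[R]_n) : Prop :=
  [/\ forall i j, 0 <= X i j,
      forall i, \sum_j X i j = 1
    & forall j, \sum_i X i j = 1].

Definition diagonal_sum (R : realFieldType) (n : nat) (X : 'M[R]_n) (s : 'S_n) : R :=
  \sum_i X i (s i).

Definition avoids_zeros (R : realFieldType) (n : nat) (A : 'M[R]_n) (s : 'S_n) : Prop :=
  forall i, A i (s i) = 1.

(* Restricted common diagonal sum. *)
Definition RCDS_with_pattern (R : realFieldType) (n : nat) (A X : 'M[R]_n) : Prop :=
  [/\ doubly_stochastic X,
      forall i j, X i j = 0 <-> A i j = 0
    & forall s t : 'S_n, avoids_zeros A s -> avoids_zeros A t ->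
        diagonal_sum X s = diagonal_sum X t].

(* Indices start at 0, so the first p rows (columns) are those with i < p. *)
Definition X' (R : realFieldType) (p k1 k2 k3 k4 : nat) (A : 'M[R]_(p + p)) :
    'M[R]_(p + p) :=
  \matrix_(i, j)
    if A i j == 1 then
      if (i < p)%N then (if (j < p)%N then k4%:R else k3%:R)
      else (if (j < p)%N then k2%:R else k1%:R)
    else 0.

(* Main.v *)
(* Since k1 + k4 = k2 + k3, the four block weights have the form u i + v j.  A
   diagonal avoiding the zeros of A therefore has sum proportional to
   \sum_i u i + \sum_j v j, whatever the permutation.  In each line of X' a
   block with k1 (resp. k2) ones per line is weighted by k4 (resp. k3), and
   conversely, so all lines sum to k1 * k4 + k2 * k3. *)

Require Import Defs.
From HB Require Import structures.
From mathcomp Require Import all_boot all_order all_algebra all_fingroup.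

Set Implicit Arguments.
Unset Strict Implicit.
Unset Printing Implicit Defensive.

Import Order.TTheory GRing.Theory Num.Theory.
Local Open Scope ring_scope.

Lemma sum_if_const (R : pzSemiRingType) (I : finType) (P : pred I) (c : R) :
  \sum_i (if P i then c else 0) = #|[set i | P i]|%:R * c.
Proof.
by rewrite -big_mkcond sumr_const mulr_natl cardsE.
Qed.

(** Trades the comparisons with [p] for blocks, so that a line sum splits into two sums over ['I_p],
    each with a single constant weight. *)
Lemma X'_block_mx (R : realFieldType) (p k1 k2 k3 k4 : nat)
    (A1 A2 A3 A4 : 'M[R]_p) :
  X' k1 k2 k3 k4 (block_mx A1 A2 A3 A4) =
  block_mx (\matrix_(i, j) if A1 i j == 1 then k4%:R else 0)
           (\matrix_(i, j) if A2 i j == 1 then k3%:R else 0)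
           (\matrix_(i, j) if A3 i j == 1 then k2%:R else 0)
           (\matrix_(i, j) if A4 i j == 1 then k1%:R else 0).
Proof.
have lt_r (i : 'I_p) : (rshift p i < p)%N = false by rewrite ltnNge leq_addr.
apply/matrixP=> i j; rewrite mxE.
by case: (split_ordP i) => i' ->; case: (split_ordP j) => j' ->;
  rewrite ?block_mxEul ?block_mxEur ?block_mxEdl ?block_mxEdr mxE ?lt_r ?ltn_ord.
Qed.

Lemma X'_row_sum (R : realFieldType) (p k1 k2 k3 k4 : nat)
    (A1 A2 A3 A4 : 'M[R]_p) (i : 'I_(p + p)) :
  ones_per_line k1 A1 -> ones_per_line k2 A2 ->
  ones_per_line k3 A3 -> ones_per_line k4 A4 ->
  \sum_j X' k1 k2 k3 k4 (block_mx A1 A2 A3 A4) i j = (k1 * k4 + k2 * k3)%:R.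
Proof.
move=> [r1 _] [r2 _] [r3 _] [r4 _]; rewrite X'_block_mx big_split_ord /=.
case: (split_ordP i) => i' ->.
  under eq_bigr do rewrite block_mxEul mxE.
  under [X in _ + X]eq_bigr do rewrite block_mxEur mxE.
  by rewrite !sum_if_const r1 r2 natrD !natrM.
under eq_bigr do rewrite block_mxEdl mxE.
under [X in _ + X]eq_bigr do rewrite block_mxEdr mxE.
by rewrite !sum_if_const r3 r4 -!natrM -natrD addnC mulnC (mulnC k3).
Qed.

(** Each block is weighted by the count of the diagonally opposite block, so pairing blocks
    vertically yields the same two products as pairing them horizontally. *)
Lemma X'_col_sum (R : realFieldType) (p k1 k2 k3 k4 : nat)
    (A1 A2 A3 A4 : 'M[R]_p) (j : 'I_(p + p)) :
  ones_per_line k1 A1 -> ones_per_line k2 A2 ->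
  ones_per_line k3 A3 -> ones_per_line k4 A4 ->
  \sum_i X' k1 k2 k3 k4 (block_mx A1 A2 A3 A4) i j = (k1 * k4 + k2 * k3)%:R.
Proof.
move=> [_ c1] [_ c2] [_ c3] [_ c4]; rewrite X'_block_mx big_split_ord /=.
case: (split_ordP j) => j' ->.
  under eq_bigr do rewrite block_mxEul mxE.
  under [X in _ + X]eq_bigr do rewrite block_mxEdl mxE.
  by rewrite !sum_if_const c1 c3 -!natrM -natrD (mulnC k3).
under eq_bigr do rewrite block_mxEur mxE.
under [X in _ + X]eq_bigr do rewrite block_mxEdr mxE.
by rewrite !sum_if_const c2 c4 -!natrM -natrD addnC (mulnC k4).
Qed.

(** A permutation meets every column once, so [s] can reindex the sum of the [v j]. *)
Lemma diagonal_sum_separable (R : realFieldType) (n : nat) (A X : 'M[R]_n)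
    (u v : 'I_n -> R) (s : 'S_n) :
  (forall i j, A i j = 1 -> X i j = u i + v j) -> avoids_zeros A s ->
  diagonal_sum X s = \sum_i u i + \sum_j v j.
Proof.
move=> XE As; rewrite /diagonal_sum [\sum_j v j](reindex_perm s) -big_split /=.
by apply: eq_bigr => i _; apply: XE.
Qed.

(** The row term is the weight in the left blocks; the column term is the change from left to right
    in the upper blocks. It is taken in [R] because it may be negative. *)
Lemma X'_row_col_decomposition (R : realFieldType) (p k1 k2 k3 k4 : nat)
    (A : 'M[R]_(p + p)) (i j : 'I_(p + p)) :
  (k1 + k4 = k2 + k3)%N -> A i j = 1 ->
  X' k1 k2 k3 k4 A i j =
    (if (i < p)%N then k4%:R else k2%:R) +
    (if (j < p)%N then 0 else k3%:R - k4%:R).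
Proof.
move=> hk Aij; rewrite mxE Aij eqxx.
case: ifP => _; case: ifP => _; rewrite ?addr0 ?[k4%:R + _]addrC ?subrK //.
(* Only the lower right block uses the balance condition: k2 + k3 - k4 = k1. *)
by rewrite addrA -natrD -hk natrD addrK.
Qed.

Theorem theorem5p4 (R : realFieldType) (p k1 k2 k3 k4 : nat)
    (A1 A2 A3 A4 : 'M[R]_p) (A : 'M[R]_(p + p))
    (hp : (1 <= p)%N)
    (hA : A = block_mx A1 A2 A3 A4)
    (hA01 : zero_one_mx A)
    (hA1 : ones_per_line k1 A1) (hA2 : ones_per_line k2 A2)
    (hA3 : ones_per_line k3 A3) (hA4 : ones_per_line k4 A4)
    (hk1 : (k1 <= p)%N) (hk2 : (k2 <= p)%N)
    (hk3 : (k3 <= p)%N) (hk4 : (k4 <= p)%N)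
    (hk : (k1 + k4 = k2 + k3)%N)
    (hX' : forall i j, 0 < X' k1 k2 k3 k4 A i j <-> A i j = 1)
    (hden : (k1 * k4 + k2 * k3)%N <> 0%N) :
  RCDS_with_pattern A
    (((k1 * k4 + k2 * k3)%:R : R)^-1 *: X' k1 k2 k3 k4 A).
Proof.
set c : R := (k1 * k4 + k2 * k3)%:R.
(* Given [hX'], the denominator vanishes only when all four counts do, that is when [A] is zero;
   [hden] excludes this case. *)
have c_neq0 : c != 0 by rewrite pnatr_eq0; apply/eqP.
have X'0 i j : A i j = 0 -> X' k1 k2 k3 k4 A i j = 0.
  by move=> Aij; rewrite mxE Aij eq_sym oner_eq0.
split; first split.
- move=> i j; rewrite mxE mulr_ge0 ?invr_ge0 ?ler0n //.
  by case: (hA01 i j) => [/X'0 -> // | /hX' /ltW].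
- move=> i; under eq_bigr do rewrite mxE.
  by rewrite -mulr_sumr hA X'_row_sum // mulVf.
- move=> j; under eq_bigr do rewrite mxE.
  by rewrite -mulr_sumr hA X'_col_sum // mulVf.
- move=> i j; rewrite mxE; split=> [/eqP | /X'0 ->]; last by rewrite mulr0.
  rewrite mulf_eq0 invr_eq0 (negbTE c_neq0) /= => /eqP X0.
  (* An entry 1 of [A] would make the entry of [X'] strictly positive. *)
  by case: (hA01 i j) => // /hX'; rewrite X0 ltxx.
- have scaled_sum s : diagonal_sum (c^-1 *: X' k1 k2 k3 k4 A) s =
      c^-1 * diagonal_sum (X' k1 k2 k3 k4 A) s.
    by rewrite /diagonal_sum mulr_sumr; apply: eq_bigr => i _; rewrite mxE.
  have XE i j := @X'_row_col_decomposition R p k1 k2 k3 k4 A i j hk.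
  move=> s t As At; rewrite !scaled_sum.
  by rewrite (diagonal_sum_separable XE As) (diagonal_sum_separable XE At).
Qed.
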